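(* Let $V$ be a vertex Leibniz algebra, let $\widetilde V$ be the associated vertex algebra without vacuum, and let $\pi_V:V\to\widetilde V$ be the canonical homomorphism of vertex Leibniz algebras. Let $K$ be any vertex algebra without vacuum and let $\psi:V\to K$ be any homomorphism of vertex Leibniz algebras. Then there exists a unique homomorphism $\tilde\psi$ of vertex algebras without vacuum from $\widetilde V$ to $K$ such that $\tilde\psi\circ\pi_V=\psi$.
   Context: All vector spaces are over $\mathbb{C}$. $V((x))$ denotes the space of lower truncated formal Laurent series, $\delta(x)=\sum_{n\in\mathbb{Z}}x^n$, and powers $(x\pm y)^n$ are expanded in nonnegative integer powers of the second variable $y$. A vertex Leibniz algebra is a vector space $V$ with a linear map $Y(\cdot,x):V\to\mathrm{Hom}(V,V((x)))$, $v\mapsto Y(v,x)=\sum_{n\in\mathbb{Z}}v_nx^{-n-1}$, such that for all $u,v\in V$ the Jacobi identity holds: $$x_0^{-1}\delta\left(\tfrac{x_1-x_2}{x_0}\right)Y(u,x_1)Y(v,x_2)-x_0^{-1}\delta\left(\tfrac{x_2-x_1}{-x_0}\right)Y(v,x_2)Y(u,x_1)=x_2^{-1}\delta\left(\tfrac{x_1-x_0}{x_2}\right)Y(Y(u,x_0)v,x_2).$$ A homomorphism of vertex Leibniz algebras is a linear map $\psi$ with $\psi(Y(u,x)v)=Y(\psi(u),x)\psi(v)$. A vertex algebra without vacuum $(K,Y,D)$ is a vertex Leibniz algebra $K$ with a linear operator $D$ such that $Y(Dv,x)=\frac{d}{dx}Y(v,x)$ and $Y(u,x)v=e^{xD}Y(v,-x)u$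 for $u,v\in K$. A homomorphism of vertex algebras without vacuum is a homomorphism of vertex Leibniz algebras that commutes with the operators $D$. Construction of $\widetilde V$ and $\pi_V$. Let $\overline V=\mathbb{C}[D]\otimes V$, where $D$ is a symbol, acting on $\overline V$ by multiplication on the first factor; $V$ is identified with $1\otimes V$. Define $\overline Y(\cdot,x)$ on $\overline V$ by the generating function $$\overline Y(e^{zD}u,x)(e^{z_0D}v)=e^{z_0D}Y(u,x+z-z_0)v\qquad(u,v\in V),$$ the right-hand side being expanded in nonnegative powers of $z,z_0$. Then $(\overline V,\overline Y)$ is a vertex Leibniz algebra containing $V$ as a vertex Leibniz subalgebra, and $D$ satisfies $[D,\overline Y(a,x)]=\overline Y(Da,x)=\frac{d}{dx}\overline Y(a,x)$ for $a\in\overline V$. Let $\overline J\subset\overline V$ be the linear span of the vectors $$u_nv-\sum_{i\ge0}(-1)^{n+i-1}\frac{1}{i!}D^i(v_{n+i}u),\qquad u,v\in\overline V,\ n\in\mathbb{Z};$$ it is a two-sided ideal, and $\widetilde V=\overline V/\overline J$ with the induced structure is a vertex algebra without vacuum. The map $\pi_V:V\to\widetilde V$ is the composition of the inclusion $V\subset\overline V$ with the quotient map $\overline V\to\overline V/\overline J$. *)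

(* Defs.v *)
From HB Require Import structures.
From mathcomp Require Import all_boot all_order all_algebra.
From mathcomp Require Import generic_quotient ring_quotient.
From mathcomp Require Import all_classical.
From mathcomp Require Import ring lra zify.

Set Implicit Arguments.
Unset Strict Implicit.
Unset Printing Implicit Defensive.

Import Order.TTheory GRing.Theory Num.Theory.

Local Open Scope classical_set_scope.
Local Open Scope ring_scope.

(* A formal series [f] in x, x^-1 is its family of coefficients [int -> W],
   [f k] being the coefficient of x^k.  In three variables the coefficient of
   x0^a x1^b x2^c is [f (a, b, c)].  Sums over infinite index sets are the
   finite-support sums [\sum_(i \in _) _] of fsbigop. *)

Section FormalCalculus.
Variable F : numFieldType.
Implicit Types (W : lmodType F).

(* n (n - 1) ... (n - i + 1) / i! *)
Definition binz (n : int) (i : nat) : F :=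
  (\prod_(k < i) (n - k%:Z)%:~R) / i`!%:R.

(* coefficient of x^a y^b in (x - y)^n, expanded in nonnegative powers of y *)
Definition binexp (n a b : int) : F :=
  if b is Posz i then
    if a == n - i%:Z then (-1) ^+ i * binz n i else 0
  else 0.

(* x0^-1 delta((x1 - x2) / x0) *)
Definition delta12 (q : int * int * int) : F :=
  binexp (- q.1.1 - 1) q.1.2 q.2.

(* x0^-1 delta((x2 - x1) / - x0) *)
Definition delta21 (q : int * int * int) : F :=
  (-1) ^ (- q.1.1 - 1) * binexp (- q.1.1 - 1) q.2 q.1.2.

(* x2^-1 delta((x1 - x0) / x2) *)
Definition delta10 (q : int * int * int) : F :=
  binexp (- q.2 - 1) q.1.2 q.1.1.

Definition dmul W (d : int * int * int -> F) (f : int * int * int -> W)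
    (p : int * int * int) : W :=
  \sum_(q \in [set: int * int * int]) d q *: f (p - q).

(* Y u v k is the coefficient of x^k in Y(u,x)v *)
Definition vertex_jacobi W (Y : W -> W -> int -> W) :=
  forall (u v w : W) (p : int * int * int),
    dmul delta12
      (fun q => if q.1.1 == 0 then Y u (Y v w q.2) q.1.2 else 0) p
  - dmul delta21
      (fun q => if q.1.1 == 0 then Y v (Y u w q.1.2) q.2 else 0) p
  = dmul delta10
      (fun q => if q.1.2 == 0 then Y (Y u v q.1.1) w q.2 else 0) p.

(* membership in W((x)) *)
Definition lower_truncated W (f : int -> W) :=
  exists N : int, forall k, k < N -> f k = 0.

Definition sderiv W (f : int -> W) (k : int) : W := (k + 1)%:~R *: f (k + 1).

(* f(- x) *)
Definition sopp W (f : int -> W) (k : int) : W := (-1) ^ k *: f k.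

(* e^(x D) f(x) *)
Definition sexp W (D : W -> W) (f : int -> W) (k : int) : W :=
  \sum_(i \in [set: nat]) i`!%:R^-1 *: iter i D (f (k - i%:Z)).

Definition lspan W (G : set W) : set W :=
  [set x | exists s : seq (F * W),
    (forall t, t \in s -> G t.2) /\ x = \sum_(t <- s) t.1 *: t.2].

End FormalCalculus.

HB.mixin Record isVertexLeibniz (F : numFieldType) V of GRing.Lmodule F V := {
  vY : V -> V -> int -> V;
  vY_linearl : forall v k, linear (fun u => vY u v k);
  vY_linearr : forall u k, linear (fun v => vY u v k);
  vY_trunc : forall u v, lower_truncated (vY u v);
  vY_jacobi : vertex_jacobi vY
}.

#[short(type="vertexLeibnizType")]
HB.structure Definition VertexLeibniz (F : numFieldType) :=
  {V of GRing.Lmodule F V & isVertexLeibniz F V}.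

HB.mixin Record isVertexWithoutVacuum (F : numFieldType) K
    of VertexLeibniz F K := {
  vD : K -> K;
  vD_linear : linear vD;
  vY_D : forall v w, vY (vD v) w =1 sderiv (vY v w);
  vY_skew : forall u v, vY u v =1 sexp vD (sopp (vY v u))
}.

#[short(type="vertexWithoutVacuumType")]
HB.structure Definition VertexWithoutVacuum (F : numFieldType) :=
  {K of VertexLeibniz F K & isVertexWithoutVacuum F K}.

Record vl_hom (F : numFieldType) (V K : vertexLeibnizType F) (f : V -> K) :
    Prop := VLHom {
  vl_hom_linear : linear f;
  vl_hom_vY : forall u v k, f (vY u v k) = vY (f u) (f v) k
}.

Record va_hom (F : numFieldType) (V K : vertexWithoutVacuumType F)
    (f : V -> K) : Prop := VAHom {
  va_hom_vl : vl_hom f;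
  va_hom_vD : forall u, f (vD u) = vD (f u)
}.

(* F[D] (x) V, as polynomials in D with coefficients in V; [tens] is the
   universal bilinear map, see [tens_universal]. *)

Section Vbar.
Variables (F : numFieldType) (V : lmodType F).

Definition finsupp : {pred nat -> V} :=
  fun f => `[< exists N, forall n, (N <= n)%N -> f n = 0 >].

Lemma finsupp_submod : submod_closed finsupp.
Proof.
split=> [|c f g /asboolP [N fN] /asboolP [M gM]]; apply/asboolP.
  by exists 0%N.
exists (maxn N M) => n; rewrite geq_max => /andP[hN hM].
by rewrite !fctE fN // gM // scaler0 addr0.
Qed.

HB.instance Definition _ :=
  GRing.isSubmodClosed.Build F (nat -> V) finsupp finsupp_submod.

Record Vbar := MkVbar { vcoef :> nat -> V; _ : vcoef \in finsupp }.

HB.instance Definition _ := [isSub for vcoef].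
HB.instance Definition _ := [Choice of Vbar by <:].
HB.instance Definition _ := [SubChoice_isSubLmodule of Vbar by <:].

Lemma vcoef_fin (a : Vbar) : exists N, forall n, (N <= n)%N -> a n = 0.
Proof. by case: a => f /= /asboolP. Qed.

End Vbar.

Section FinSums.
Variables (F : numFieldType) (W : lmodType F).
Implicit Types (f g : nat -> W) (N : nat).

Definition evz f N := forall i, (N <= i)%N -> f i = 0.

Lemma fsum_nat f N : evz f N ->
  \sum_(i \in [set: nat]) f i = \sum_(i < N) f i.
Proof.
move=> fN; rewrite fsbig_ord; apply/esym/fsbig_widen => // i [_ /= /negP].
by rewrite -leqNgt => /fN.
Qed.

Lemma fsum_inj (T : choiceType) (h : nat -> T) (f : T -> W) : injective h ->
  (forall t, f t != 0 -> exists i, t = h i) ->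
  \sum_(t \in [set: T]) f t = \sum_(i \in [set: nat]) f (h i).
Proof.
move=> hI fh; rewrite -(@fsbig_image _ _ _ _ _ setT h f); last first.
  by move=> i j _ _ /hI.
apply/esym/fsbig_widen => // t [_ /= nt]; apply: contrapT => /eqP/fh [i ti].
by apply: nt; exists i.
Qed.

Lemma fsumD f g N : evz f N -> evz g N ->
  \sum_(i \in [set: nat]) (f i + g i) =
  \sum_(i \in [set: nat]) f i + \sum_(i \in [set: nat]) g i.
Proof.
move=> fN gN; rewrite !(@fsum_nat _ N) ?big_split // => i iN.
by rewrite fN // gN // addr0.
Qed.

Lemma fsumZ c f N : evz f N ->
  \sum_(i \in [set: nat]) (c *: f i) = c *: \sum_(i \in [set: nat]) f i.
Proof.
move=> fN; rewrite !(@fsum_nat _ N) ?scaler_sumr // => i iN.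
by rewrite fN // scaler0.
Qed.

Lemma fsumS f N : evz f N ->
  \sum_(i \in [set: nat]) f i = f 0%N + \sum_(i \in [set: nat]) f i.+1.
Proof.
move=> fN; rewrite (@fsum_nat f N.+1); last by move=> i /ltnW; apply: fN.
by rewrite big_ord_recl (@fsum_nat _ N) // => i iN; apply: fN; apply: leqW.
Qed.

Lemma fsum_comb c d f g h N : evz f N -> evz g N ->
  (forall i, h i = c *: f i + d *: g i) ->
  \sum_(i \in [set: nat]) h i =
  c *: \sum_(i \in [set: nat]) f i + d *: \sum_(i \in [set: nat]) g i.
Proof.
move=> fN gN hE; rewrite !(@fsum_nat _ N) //; last first.
  by move=> i iN; rewrite hE fN // gN // !scaler0 addr0.
rewrite !scaler_sumr -big_split.
by apply: eq_bigr => i _; rewrite hE.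
Qed.

End FinSums.

Lemma fsum_lin (F : numFieldType) (W U : lmodType F) (L : W -> U)
    (f : nat -> W) N : linear L -> evz f N ->
  L (\sum_(i \in [set: nat]) f i) = \sum_(i \in [set: nat]) L (f i).
Proof.
move=> Ll fN; pose L' : {linear W -> U} :=
  HB.pack L (GRing.isLinear.Build F W U *:%R L Ll).
rewrite (fsum_nat fN) -[LHS]/(L' _) linear_sum (@fsum_nat F U (L \o f) N) // => i iN.
by rewrite /= fN // -[LHS]/(L' _) linear0.
Qed.

Section Binz.
Variable F : numFieldType.
Local Notation binz := (@binz F).

Lemma binz0 n : binz n 0 = 1.
Proof. by rewrite /binz big_ord0 fact0 divr1. Qed.

Lemma binzS_mul n i : i.+1%:R * binz n i.+1 = (n - i%:Z)%:~R * binz n i.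
Proof.
rewrite /binz big_ord_recr /= factS natrM invfM.
have iN : i.+1%:R != 0 :> F by rewrite pnatr_eq0.
have jN : i`!%:R != 0 :> F by rewrite pnatr_eq0 -lt0n fact_gt0.
by field; rewrite addrC natr1 iN jN.
Qed.

Lemma binz_absorb n i : i.+1%:R * binz n i.+1 = n%:~R * binz (n - 1) i.
Proof.
rewrite /binz big_ord_recl /= factS natrM invfM subr0.
rewrite (eq_bigr (fun k : 'I_i => (n - 1 - k%:Z)%:~R)); last first.
  by move=> k _; rewrite /bump /= PoszD opprD addrA.
have iN : i.+1%:R != 0 :> F by rewrite pnatr_eq0.
have jN : i`!%:R != 0 :> F by rewrite pnatr_eq0 -lt0n fact_gt0.
by field; rewrite addrC natr1 iN jN.
Qed.

Lemma binz_absorb0 n i : n%:~R * binz (n - 1) i = (n - i%:Z)%:~R * binz n i.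
Proof. by rewrite -binz_absorb binzS_mul. Qed.

Lemma binz0n i : binz 0 i.+1 = 0.
Proof. by rewrite /binz big_ord_recl /= subr0 mul0r mul0r. Qed.

Lemma binzN n i : (-1) ^+ i * binz (i%:Z - n - 1) i = binz n i.
Proof.
rewrite /binz mulrA; congr (_ / _).
rewrite -[in (-1) ^+ i](card_ord i) -prodr_const -big_split /=.
rewrite [RHS](reindex_inj rev_ord_inj) /=.
by apply: eq_bigr => -[k ki] _ /=; rewrite mulN1r -intrN; congr (_%:~R); lia.
Qed.

End Binz.

Arguments binexp : simpl never.

Section Borcherds.
Variables (F : numFieldType) (W : lmodType F).
Variable Y : W -> W -> int -> W.
Hypothesis Ylinl : forall v k, linear (fun u => Y u v k).
Hypothesis Ylinr : forall u k, linear (fun v => Y u v k).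
Hypothesis Ytr : forall u v, lower_truncated (Y u v).
Local Notation binz := (@binz F).
Local Notation mo u n v := (Y u v (- n - 1)).

Let YlM v k : {linear W -> W} :=
  HB.pack (fun u => Y u v k) (GRing.isLinear.Build F W W *:%R _ (Ylinl v k)).
Let YrM u k : {linear W -> W} :=
  HB.pack (fun v => Y u v k) (GRing.isLinear.Build F W W *:%R _ (Ylinr u k)).
Lemma Y0l v k : Y 0 v k = 0. Proof. exact: (linear0 (YlM v k)). Qed.
Lemma Y0r v k : Y v 0 k = 0. Proof. exact: (linear0 (YrM v k)). Qed.
Lemma YNl u v k : Y (- u) v k = - Y u v k.
Proof. exact: (linearN (YlM v k)). Qed.
Lemma YNr u v k : Y u (- v) k = - Y u v k.
Proof. exact: (linearN (YrM u k)). Qed.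
Lemma YDl u u' v k : Y (u + u') v k = Y u v k + Y u' v k.
Proof. exact: (linearD (YlM v k)). Qed.
Lemma YDr u v v' k : Y u (v + v') k = Y u v k + Y u v' k.
Proof. exact: (linearD (YrM u k)). Qed.
Lemma YZl c u v k : Y (c *: u) v k = c *: Y u v k.
Proof. exact: (linearZ_LR (YlM v k)). Qed.
Lemma YZr c u v k : Y u (c *: v) k = c *: Y u v k.
Proof. exact: (linearZ_LR (YrM u k)). Qed.

Definition bt1 u v w l m n i :=
  ((-1) ^+ i * binz l i) *: mo u (l + m - i%:Z) (mo v (n + i%:Z) w).
Definition bt2 u v w l m n i :=
  ((-1) ^ l * ((-1) ^+ i * binz l i)) *:
    mo v (n + l - i%:Z) (mo u (m + i%:Z) w).
Definition bt3 u v w l m n i :=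
  binz m i *: mo (mo u (l + i%:Z) v) (m + n - i%:Z) w.

Definition borch u v w l m n :=
  \sum_(i \in [set: nat]) bt1 u v w l m n i
  - \sum_(i \in [set: nat]) bt2 u v w l m n i
  - \sum_(i \in [set: nat]) bt3 u v w l m n i.

Lemma mo_evz u v n : exists N : nat, forall i, (N <= i)%N ->
  mo u (n + i%:Z) v = 0.
Proof.
have [N YN] := Ytr u v; exists (absz (N + n)) => i iN; apply: YN; lia.
Qed.

Lemma bt1_evz u v w l m n : exists N, evz (bt1 u v w l m n) N.
Proof.
have [N YN] := mo_evz v w n; exists N => i iN.
by rewrite /bt1 YN // Y0r scaler0.
Qed.
Lemma bt2_evz u v w l m n : exists N, evz (bt2 u v w l m n) N.
Proof.
have [N YN] := mo_evz u w m; exists N => i iN.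
by rewrite /bt2 YN // Y0r scaler0.
Qed.
Lemma bt3_evz u v w l m n : exists N, evz (bt3 u v w l m n) N.
Proof.
have [N YN] := mo_evz u v l; exists N => i iN.
by rewrite /bt3 YN // Y0l scaler0.
Qed.

Lemma binexpE n i : binexp F n (n - i%:Z) i%:Z = (-1) ^+ i * binz n i.
Proof. by rewrite /binexp eqxx. Qed.

Lemma binexp_neq0 n a b : binexp F n a b != 0 ->
  exists i : nat, a = n - i%:Z /\ b = i%:Z.
Proof.
rewrite /binexp; case: b => [i|i]; last by rewrite eqxx.
by case: (a =P _) => [-> _|_]; [exists i | rewrite eqxx].
Qed.

Lemma dmul12E u v w l m n :
  dmul (@delta12 F)
      (fun q => if q.1.1 == 0 then Y u (Y v w q.2) q.1.2 else 0)
      (- l - 1, - m - 1, - n - 1) =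
  \sum_(i \in [set: nat]) bt1 u v w l m n i.
Proof.
rewrite /dmul (@fsum_inj F W _ (fun i => (- l - 1, l - i%:Z, i%:Z))).
- apply: eq_fsbigr => i _; rewrite /bt1 /delta12 /= subrr eqxx.
  rewrite (_ : - (- l - 1) - 1 = l); last by lia.
  rewrite binexpE; congr (_ *: Y _ (Y _ _ _) _); lia.
- by move=> i j [] _ [].
- move=> [[a b] c] /=; rewrite scaler_eq0 negb_or => /andP[/binexp_neq0 /=].
  move=> [i [-> ->]]; case: ifP; last by rewrite eqxx.
  move=> /eqP /= e _; exists i; congr (_, _, _); lia.
Qed.

Lemma dmul21E u v w l m n :
  dmul (@delta21 F)
      (fun q => if q.1.1 == 0 then Y v (Y u w q.1.2) q.2 else 0)
      (- l - 1, - m - 1, - n - 1) =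
  \sum_(i \in [set: nat]) bt2 u v w l m n i.
Proof.
rewrite /dmul (@fsum_inj F W _ (fun i => (- l - 1, i%:Z, l - i%:Z))).
- apply: eq_fsbigr => i _; rewrite /bt2 /delta21 /= subrr eqxx.
  rewrite (_ : - (- l - 1) - 1 = l); last by lia.
  rewrite binexpE; congr (_ *: Y _ (Y _ _ _) _); lia.
- by move=> i j [].
- move=> [[a b] c] /=; rewrite scaler_eq0 negb_or => /andP[].
  rewrite /delta21 mulf_eq0 negb_or => /andP[_ /binexp_neq0 /=].
  move=> [i [-> ->]]; case: ifP; last by rewrite eqxx.
  move=> /eqP /= e _; exists i; congr (_, _, _); lia.
Qed.

Lemma dmul10E u v w l m n :
  dmul (@delta10 F)
      (fun q => if q.1.2 == 0 then Y (Y u v q.1.1) w q.2 else 0)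
      (- l - 1, - m - 1, - n - 1) =
  \sum_(i \in [set: nat]) bt3 u v w l m n i.
Proof.
rewrite /dmul (@fsum_inj F W _ (fun i => (i%:Z, - m - 1, m - i%:Z))).
- apply: eq_fsbigr => i _; rewrite /bt3 /delta10 /= subrr eqxx.
  rewrite (_ : - m - 1 = - (m - i%:Z) - 1 - i%:Z); last by lia.
  rewrite binexpE.
  rewrite (_ : - (m - i%:Z) - 1 = i%:Z - m - 1); last by lia.
  rewrite binzN; congr (_ *: Y (Y _ _ _) _ _); lia.
- by move=> i j [].
- move=> [[a b] c] /=; rewrite scaler_eq0 negb_or => /andP[].
  rewrite /delta10 => /binexp_neq0 /= [i [-> ->]].
  case: ifP; last by rewrite eqxx.
  move=> /eqP /= e _; exists i; congr (_, _, _); lia.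
Qed.

Lemma jacobiP :
  vertex_jacobi Y <-> forall u v w l m n, borch u v w l m n = 0.
Proof.
split=> [Yj u v w l m n|Yb u v w [[a b] c]].
  rewrite /borch -dmul12E -dmul21E -dmul10E.
  by apply/eqP; rewrite subr_eq0; apply/eqP; exact: Yj.
rewrite (_ : a = - (- a - 1) - 1); last by lia.
rewrite (_ : b = - (- b - 1) - 1); last by lia.
rewrite (_ : c = - (- c - 1) - 1); last by lia.
rewrite dmul12E dmul21E dmul10E.
by apply/eqP; rewrite -subr_eq0; apply/eqP; exact: Yb.
Qed.

End Borcherds.

Section FinSums2.
Variables (F : numFieldType) (W : lmodType F).
Implicit Types (f g h : nat -> W).
Local Notation S f := (\sum_(i \in [set: nat]) f i).

Lemma evz_le f N M : (N <= M)%N -> evz f N -> evz f M.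
Proof. by move=> NM fN i /(leq_trans NM); apply: fN. Qed.

Lemma evz2 f g : (exists N, evz f N) -> (exists N, evz g N) ->
  exists N, evz f N /\ evz g N.
Proof.
move=> [N fN] [M gM]; exists (maxn N M); split.
  exact: evz_le (leq_maxl _ _) fN.
exact: evz_le (leq_maxr _ _) gM.
Qed.

Lemma fsum_cmb c d f g h :
  (exists N, evz f N) -> (exists N, evz g N) ->
  (forall i, h i = c *: f i + d *: g i) ->
  S h = c *: S f + d *: S g.
Proof. by move=> /evz2 /[apply] -[N [fN gN]]; apply: fsum_comb fN gN. Qed.

Lemma fsum_shift c d f g h :
  (exists N, evz f N) -> (exists N, evz g N) ->
  h 0%N = d *: g 0%N ->
  (forall i, h i.+1 = c *: f i + d *: g i.+1) ->
  S h = c *: S f + d *: S g.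
Proof.
move=> /evz2 /[apply] -[N [fN gN]] h0 hS.
have hN : evz h N.+1.
  by case=> // i iN; rewrite hS fN // gN ?scaler0 ?addr0 // ltnW.
rewrite (fsumS hN) h0 (fsumS gN).
rewrite (@fsum_cmb c d f (fun i => g i.+1) (fun i => h i.+1)) //.
- by rewrite scalerDr addrCA.
- by exists N.
- by exists N => i iN; apply: gN; apply: leqW.
Qed.

Lemma fsum_sub3 f g h k :
  (exists N, evz f N) -> (exists N, evz g N) -> (exists N, evz h N) ->
  (forall i, k i = f i - g i - h i) -> S k = S f - S g - S h.
Proof.
move=> ef eg [P hP] E; have [N [fN gN]] := evz2 ef eg.
rewrite (@fsum_cmb 1 (- 1) (fun i => f i - g i) h k) ?scale1r ?scaleN1r //.
- congr (_ - _); rewrite (@fsum_cmb 1 (- 1) f g) ?scale1r ?scaleN1r //.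
  by move=> i; rewrite scale1r scaleN1r.
- by exists N => i iN; rewrite fN // gN // subr0.
- by exists P.
- by move=> i; rewrite scale1r scaleN1r E.
Qed.

Lemma rear (a1 a2 b1 b2 c1 c2 : W) :
  (a1 + a2) - (b1 + b2) - (c1 + c2) = (a1 - b1 - c1) + (a2 - b2 - c2).
Proof. by rewrite (opprD b1) (opprD c1) (addrACA a1) (addrACA (a1 - b1)). Qed.

Lemma signz_pred (l : int) : (-1) ^ (l - 1) = - (-1) ^ l :> F.
Proof.
have n1 : (-1 : F) != 0 by rewrite oppr_eq0 oner_neq0.
rewrite expfzDr // exprN1 invrN invr1 mulrN1 //.
Qed.

End FinSums2.

Section Deriv.
Variables (F : numFieldType) (W : lmodType F).
Variable Y : W -> W -> int -> W.
Hypothesis Ylinl : forall v k, linear (fun u => Y u v k).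
Hypothesis Ylinr : forall u k, linear (fun v => Y u v k).
Hypothesis Ytr : forall u v, lower_truncated (Y u v).
Variable D : W -> W.
Hypothesis Dlin : linear D.
Hypothesis YD : forall u v k, Y (D u) v k = (k + 1)%:~R *: Y u v (k + 1).
Hypothesis DY : forall u v k, D (Y u v k) = Y (D u) v k + Y u (D v) k.
Local Notation S f := (\sum_(i \in [set: nat]) f i).
Local Notation mo u n v := (Y u v (- n - 1)).
Local Notation bt1 := (bt1 Y). Local Notation bt2 := (bt2 Y).
Local Notation bt3 := (bt3 Y). Local Notation borch := (borch Y).
Let e1 := @bt1_evz F W Y Ylinr Ytr.
Let e2 := @bt2_evz F W Y Ylinr Ytr.
Let e3 := @bt3_evz F W Y Ylinl Ytr.
Let YZl := @YZl F W Y Ylinl. Let YZr := @YZr F W Y Ylinr.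
Let YDl := @YDl F W Y Ylinl. Let YDr := @YDr F W Y Ylinr.
Let YE0l := @Y0l F W Y Ylinl.

Lemma moD u v n : mo (D u) n v = (- n)%:~R *: mo u (n - 1) v.
Proof. by rewrite YD; congr (_%:~R *: Y _ _ _); lia. Qed.

Lemma b1Du u v w l m n : S (bt1 (D u) v w l m n) =
  (- l)%:~R *: S (bt1 u v w (l - 1) m n) + (- m)%:~R *: S (bt1 u v w l (m - 1) n).
Proof.
apply: fsum_cmb => // i; rewrite /bt1 moD !scalerA.
rewrite (_ : l - 1 + m - i%:Z = l + m - i%:Z - 1); last by lia.
rewrite (_ : l + (m - 1) - i%:Z = l + m - i%:Z - 1); last by lia.
rewrite -scalerDl; congr (_ *: _).
have := binz_absorb0 F l i; rewrite !intrD !intrN => e.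
transitivity (- ((-1) ^+ i * (l%:~R * binz F (l - 1) i))
  - m%:~R * ((-1) ^+ i * binz F l i)); last by ring.
by rewrite e; ring.
Qed.

Lemma b2Du u v w l m n : S (bt2 (D u) v w l m n) =
  (- l)%:~R *: S (bt2 u v w (l - 1) m n) + (- m)%:~R *: S (bt2 u v w l (m - 1) n).
Proof.
apply: fsum_shift => // [|i]; rewrite /bt2 moD YZr !scalerA.
  rewrite (_ : m + 0%:Z - 1 = m - 1 + 0%:Z); last by lia.
  by congr (_ *: _); rewrite addr0 mulrC.
rewrite (_ : n + (l - 1) - i%:Z = n + l - i.+1%:Z); last by lia.
rewrite (_ : m + i.+1%:Z - 1 = m + i%:Z); last by lia.
rewrite (_ : m - 1 + i.+1%:Z = m + i%:Z); last by lia.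
rewrite -scalerDl; congr (_ *: _).
have := binz_absorb F l i; rewrite signz_pred exprS => e.
rewrite [in LHS]opprD intrD mulrDr [LHS]addrC; congr (_ + _); last by ring.
rewrite !intrN; transitivity ((-1) ^ l * ((-1) ^+ i * (i.+1%:R * binz F l i.+1))).
  by ring.
by rewrite e; ring.
Qed.

Lemma b3Du u v w l m n : S (bt3 (D u) v w l m n) =
  (- l)%:~R *: S (bt3 u v w (l - 1) m n) + (- m)%:~R *: S (bt3 u v w l (m - 1) n).
Proof.
rewrite addrC; apply: fsum_shift => // [|i]; rewrite /bt3 moD YZl !scalerA.
  rewrite (_ : l + 0%:Z - 1 = l - 1 + 0%:Z); last by lia.
  by congr (_ *: _); rewrite addr0 mulrC.
rewrite (_ : l + i.+1%:Z - 1 = l + i%:Z); last by lia.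
rewrite (_ : l - 1 + i.+1%:Z = l + i%:Z); last by lia.
rewrite (_ : m - 1 + n - i%:Z = m + n - i.+1%:Z); last by lia.
rewrite -scalerDl; congr (_ *: _).
have := binz_absorb F m i => e.
rewrite [in LHS]opprD intrD mulrDr [LHS]addrC; congr (_ + _); last by ring.
rewrite !intrN mulrN mulrC [_%:~R * _]e; ring.
Qed.

Lemma borchDu u v w l m n : borch (D u) v w l m n =
  (- l)%:~R *: borch u v w (l - 1) m n + (- m)%:~R *: borch u v w l (m - 1) n.
Proof. by rewrite /borch b1Du b2Du b3Du rear !scalerBr. Qed.


Let DM : {linear W -> W} := HB.pack D (GRing.isLinear.Build F W W *:%R D Dlin).
Let DZ c a : D (c *: a) = c *: D a. Proof. exact: (linearZ_LR DM). Qed.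
Let D0 : D 0 = 0. Proof. exact: (linear0 DM). Qed.
Let DB a b : D (a - b) = D a - D b. Proof. exact: (linearB DM). Qed.

Lemma b1Dv u v w l m n : S (bt1 u (D v) w l m n) =
  l%:~R *: S (bt1 u v w (l - 1) m n) + (- n)%:~R *: S (bt1 u v w l m (n - 1)).
Proof.
apply: fsum_shift => // [|i]; rewrite /bt1 moD YZr !scalerA.
  rewrite (_ : n + 0%:Z - 1 = n - 1 + 0%:Z); last by lia.
  by congr (_ *: _); rewrite addr0 mulrC.
rewrite (_ : l - 1 + m - i%:Z = l + m - i.+1%:Z); last by lia.
rewrite (_ : n + i.+1%:Z - 1 = n + i%:Z); last by lia.
rewrite (_ : n - 1 + i.+1%:Z = n + i%:Z); last by lia.
rewrite -scalerDl; congr (_ *: _).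
have := binz_absorb F l i; rewrite exprS => e.
rewrite [in LHS]opprD intrD mulrDr [LHS]addrC; congr (_ + _); last by ring.
rewrite !intrN; transitivity ((-1) ^+ i * (i.+1%:R * binz F l i.+1)).
  by ring.
by rewrite e; ring.
Qed.

Lemma b2Dv u v w l m n : S (bt2 u (D v) w l m n) =
  l%:~R *: S (bt2 u v w (l - 1) m n) + (- n)%:~R *: S (bt2 u v w l m (n - 1)).
Proof.
apply: fsum_cmb => // i; rewrite /bt2 moD !scalerA.
rewrite (_ : n + (l - 1) - i%:Z = n + l - i%:Z - 1); last by lia.
rewrite (_ : n - 1 + l - i%:Z = n + l - i%:Z - 1); last by lia.
rewrite -scalerDl; congr (_ *: _).
have := binz_absorb0 F l i; rewrite !intrD !intrN signz_pred => e.
transitivity (- ((-1) ^ l * ((-1) ^+ i * (l%:~R * binz F (l - 1) i)))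
  - n%:~R * ((-1) ^ l * ((-1) ^+ i * binz F l i))); last by ring.
by rewrite e; ring.
Qed.

Lemma b3Dout u v w l m n :
  S (fun i => binz F m i *: mo (D (mo u (l + i%:Z) v)) (m + n - i%:Z) w) =
  (- n)%:~R *: S (bt3 u v w l m (n - 1)) + (- m)%:~R *: S (bt3 u v w l (m - 1) n).
Proof.
apply: fsum_cmb => // i; rewrite /bt3 moD !scalerA.
rewrite (_ : m + (n - 1) - i%:Z = m + n - i%:Z - 1); last by lia.
rewrite (_ : m - 1 + n - i%:Z = m + n - i%:Z - 1); last by lia.
rewrite -scalerDl; congr (_ *: _).
have := binz_absorb0 F m i; rewrite !intrD !intrN => e.
transitivity (- (m%:~R * binz F (m - 1) i)
  - n%:~R * binz F m i); last by ring.
by rewrite e; ring.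
Qed.

Lemma b3Dv u v w l m n : S (bt3 u (D v) w l m n) =
  l%:~R *: S (bt3 u v w (l - 1) m n) + (- n)%:~R *: S (bt3 u v w l m (n - 1)).
Proof.
rewrite (@fsum_sub3 _ _
  (fun i => binz F m i *: mo (D (mo u (l + i%:Z) v)) (m + n - i%:Z) w)
  (bt3 (D u) v w l m n) (fun=> 0)).
- rewrite b3Dout b3Du [X in _ - X]fsbig1 // subr0 opprD addrACA addrN addr0.
  by rewrite addrC intrN scaleNr opprK.
- have [N uN] := mo_evz Ytr u v l; exists N => i iN.
  by rewrite uN // D0 YE0l scaler0.
- exact: e3.
- by exists 0%N.
- by move=> i; rewrite /bt3 DY YDl scalerDr subr0 [X in _ = X - _]addrC addrK.
Qed.

Lemma borchDv u v w l m n : borch u (D v) w l m n =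
  l%:~R *: borch u v w (l - 1) m n + (- n)%:~R *: borch u v w l m (n - 1).
Proof. by rewrite /borch b1Dv b2Dv b3Dv rear !scalerBr. Qed.

Let evD (f : nat -> W) : (exists N, evz f N) -> exists N, evz (D \o f) N.
Proof. by move=> [N fN]; exists N => i iN; rewrite /= fN. Qed.

Let DS (f : nat -> W) : (exists N, evz f N) -> D (S f) = S (D \o f).
Proof. by move=> [N fN]; rewrite (fsum_lin Dlin fN). Qed.

Let rear2 (a b c a' b' c' : W) :
  (a - a') - (b - b') - (c - c') = (a - b - c) - (a' - b' - c').
Proof. by rewrite rear !opprD !opprK. Qed.

Let rear3 (a b c a' b' c' a'' b'' c'' : W) :
  (a - a' - a'') - (b - b' - b'') - (c - c' - c'') =
  (a - b - c) - (a' - b' - c') - (a'' - b'' - c'').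
Proof. by rewrite (rear2 (a - a')) (rear2 a). Qed.

Let canc (a b c : W) : a + (b + c) - a - b = c.
Proof. by rewrite [a + _]addrC addrK [b + _]addrC addrK. Qed.

Lemma borchDw u v w l m n : borch u v (D w) l m n =
  D (borch u v w l m n) - borch (D u) v w l m n - borch u (D v) w l m n.
Proof.
have E1 : S (bt1 u v (D w) l m n) = D (S (bt1 u v w l m n))
    - S (bt1 (D u) v w l m n) - S (bt1 u (D v) w l m n).
  rewrite DS //; apply: fsum_sub3 => // [|i]; first exact: evD.
  rewrite /bt1 /= DZ !DY YDr !scalerDr.
  by rewrite canc.
have E2 : S (bt2 u v (D w) l m n) = D (S (bt2 u v w l m n))
    - S (bt2 (D u) v w l m n) - S (bt2 u (D v) w l m n).
  rewrite DS //; apply: fsum_sub3 => // [|i]; first exact: evD.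
  rewrite /bt2 /= DZ !DY YDr !scalerDr.
  by rewrite [RHS]addrAC canc.
have E3 : S (bt3 u v (D w) l m n) = D (S (bt3 u v w l m n))
    - S (bt3 (D u) v w l m n) - S (bt3 u (D v) w l m n).
  rewrite DS //; apply: fsum_sub3 => // [|i]; first exact: evD.
  rewrite /bt3 /= DZ !DY YDl !scalerDr.
  by rewrite -[X in _ = X - _ - _]addrA canc.
by rewrite /borch E1 E2 E3 !DB rear3.
Qed.

End Deriv.

Section Tensor.
Variables (F : numFieldType) (V : lmodType F).

Lemma tens_fin (p : {poly F}) (v : V) :
  (fun n => p`_n *: v) \in finsupp (V := V).
Proof.
apply/asboolP; exists (size p) => n pn.
by rewrite nth_default // scale0r.
Qed.

Definition tens (p : {poly F}) (v : V) : Vbar V := MkVbar (tens_fin p v).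

Lemma vbarD_fin (a : Vbar V) :
  (fun n => if n is m.+1 then a m else 0) \in finsupp (V := V).
Proof.
have [N aN] := vcoef_fin a; apply/asboolP; exists N.+1 => -[|n] // nN.
exact: aN.
Qed.

(* multiplication by D, see [vbarD_tens] *)
Definition vbarD (a : Vbar V) : Vbar V := MkVbar (vbarD_fin a).

Lemma vbarP (a b : Vbar V) : (forall n, a n = b n) -> a = b.
Proof. by move=> ab; apply: val_inj; apply/funext. Qed.

Lemma vcoefD (a b : Vbar V) n : (a + b) n = a n + b n. Proof. by []. Qed.
Lemma vcoefZ c (a : Vbar V) n : (c *: a) n = c *: a n. Proof. by []. Qed.
Lemma vcoef0 n : (0 : Vbar V) n = 0. Proof. by []. Qed.

Lemma vcoef_sum (I : Type) (r : seq I) (P : pred I) (G : I -> Vbar V) n :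
  (\sum_(i <- r | P i) G i) n = \sum_(i <- r | P i) G i n.
Proof. exact: (big_morph (fun a : Vbar V => a n) (fun a b => vcoefD a b n)). Qed.

Lemma vbarD_tens p v : vbarD (tens p v) = tens ('X * p) v.
Proof. by apply: vbarP => -[|n]; rewrite /= coefXM ?scale0r. Qed.

Lemma tens_linearl v : linear (tens ^~ v).
Proof.
move=> c p q; apply: vbarP => n.
by rewrite vcoefD vcoefZ /= coefD coefZ scalerDl scalerA.
Qed.

Lemma tens_linearr p : linear (tens p).
Proof.
move=> c u v; apply: vbarP => n.
by rewrite vcoefD vcoefZ /= scalerDr !scalerA mulrC.
Qed.

Lemma vbarD_linear : linear vbarD.
Proof. by move=> c a b; apply: vbarP => -[|n];
  rewrite !(vcoefD, vcoefZ) //= scaler0 addr0. Qed.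

Lemma vbar_decomp (a : Vbar V) N : (forall n, (N <= n)%N -> a n = 0) ->
  a = \sum_(n < N) tens 'X^n (a n).
Proof.
move=> aN; apply: vbarP => n; rewrite vcoef_sum /=.
under eq_bigr do rewrite coefXn.
have [nN|Nn] := ltnP n N.
  rewrite (bigD1 (Ordinal nN)) //= eqxx scale1r big1 ?addr0 // => i.
  by rewrite -val_eqE /= eq_sym => /negbTE ->; rewrite scale0r.
rewrite aN // big1 // => -[i iN] _ /=.
by rewrite gtn_eqF ?scale0r // (leq_trans iN).
Qed.

Lemma tens_universal (U : lmodType F) (B : {poly F} -> V -> U) :
  (forall v, linear (B ^~ v)) -> (forall p, linear (B p)) ->
  exists! f : Vbar V -> U, linear f /\ forall p v, f (tens p v) = B p v.
Proof.
move=> Bl Br.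
pose BlM v : {linear {poly F} -> U} :=
  HB.pack (B ^~ v) (GRing.isLinear.Build F _ U *:%R _ (Bl v)).
pose BrM p : {linear V -> U} :=
  HB.pack (B p) (GRing.isLinear.Build F V U *:%R _ (Br p)).
have B0 p : B p 0 = 0 by exact: (linear0 (BrM p)).
pose f (a : Vbar V) := \sum_(n \in [set: nat]) B 'X^n (a n).
have fE (a : Vbar V) N : (forall n, (N <= n)%N -> a n = 0) ->
    f a = \sum_(n < N) B 'X^n (a n).
  by move=> aN; apply: fsum_nat => n /aN ->.
have fl : linear f.
  move=> c a b; have [N aN] := vcoef_fin a; have [M bM] := vcoef_fin b.
  have aX n : (maxn N M <= n)%N -> a n = 0.
    by rewrite geq_max => /andP[/aN].
  have bX n : (maxn N M <= n)%N -> b n = 0.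
    by rewrite geq_max => /andP[_ /bM].
  rewrite (fE _ _ aX) (fE _ _ bX) (fE _ (maxn N M)); last first.
    by move=> n nX; rewrite vcoefD vcoefZ aX // bX // scaler0 addr0.
  rewrite scaler_sumr -big_split; apply: eq_bigr => n _ /=.
  exact: Br.
have ft p v : f (tens p v) = B p v.
  rewrite (fE _ (size p)) /=; last first.
    by move=> n pn; rewrite nth_default // scale0r.
  rewrite -[in RHS](coefK p) poly_def -[RHS]/(BlM v _) linear_sum.
  by apply: eq_bigr => n _; rewrite linearZ_LR -[LHS]/(BrM _ _) linearZ_LR.
exists f; split=> // g [gl gt]; apply/funext => a.
pose gM : {linear Vbar V -> U} :=
  HB.pack g (GRing.isLinear.Build F _ U *:%R _ gl).
have [N aN] := vcoef_fin a.
rewrite (fE _ _ aN) [in RHS](vbar_decomp aN) -[RHS]/(gM _) linear_sum.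
by apply: eq_bigr => n _; rewrite -[RHS]/(g _) gt.
Qed.

Lemma tensXS n v : tens 'X^(n.+1) v = vbarD (tens 'X^n v).
Proof. by rewrite vbarD_tens -exprS. Qed.

Lemma vbar_ind (P : Vbar V -> Prop) :
  P 0 -> (forall a b, P a -> P b -> P (a + b)) ->
  (forall n v, P (tens 'X^n v)) -> forall a, P a.
Proof.
move=> P0 PD PX a; have [N aN] := vcoef_fin a.
by rewrite (vbar_decomp aN); elim/big_ind: _.
Qed.

Lemma vbar_indD (P : Vbar V -> Prop) :
  P 0 -> (forall a b, P a -> P b -> P (a + b)) ->
  (forall v, P (tens 1 v)) -> (forall a, P a -> P (vbarD a)) -> forall a, P a.
Proof.
move=> P0 PD P1 PDD; apply: vbar_ind => // n v.
by elim: n => [|n IH]; rewrite ?expr0 // tensXS; apply: PDD.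
Qed.

End Tensor.

Section Ybar.
Variables (F : numFieldType) (V : vertexLeibnizType F).

(* coefficient of x^k z^i z0^j in Y(u, x + z - z0) v, using
   (x + (z - z0))^n = sum_p binz n p x^(n-p) (z - z0)^p *)
Definition Yshift (u v : V) (k : int) (i j : nat) : V :=
  (binz F (k + (i + j)%N%:Z) (i + j) * 'C(i + j, i)%:R * (-1) ^+ j)
    *: vY u v (k + (i + j)%N%:Z).

(* coefficient of x^k z^i z0^j in e^(z0 D) Y(u, x + z - z0) v *)
Definition Ybar_exp (u v : V) (k : int) (i j : nat) : Vbar V :=
  \sum_(l < j.+1) l`!%:R^-1 *: tens 'X^l (Yshift u v k i (j - l)).

(* The generating function defines Ybar (D^i u) (D^j v) as i! j! times the
   coefficient of z^i z0^j in e^(z0 D) Y(u, x + z - z0) v, see [Ybar_mono];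
   [a i] is the coefficient in V of D^i in [a]. *)
Definition Ybar (a b : Vbar V) (k : int) : Vbar V :=
  \sum_(p \in [set: nat * nat])
    (p.1`! * p.2`!)%:R *: Ybar_exp (a p.1) (b p.2) k p.1 p.2.

Local Notation Yl := (@Y0l F V _ vY_linearl).
Local Notation Yr := (@Y0r F V _ vY_linearr).

Lemma Yshift_linl v k i j : linear (fun u => Yshift u v k i j).
Proof. by move=> c u u'; rewrite /Yshift vY_linearl scalerDr !scalerA mulrC. Qed.
Lemma Yshift_linr u k i j : linear (fun v => Yshift u v k i j).
Proof. by move=> c v v'; rewrite /Yshift vY_linearr scalerDr !scalerA mulrC. Qed.

Lemma Yexp_linl v k i j : linear (fun u => Ybar_exp u v k i j).
Proof.
move=> c u u'; rewrite /Ybar_exp scaler_sumr -big_split; apply: eq_bigr => l _ /=.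
by rewrite Yshift_linl tens_linearr scalerDr !scalerA mulrC.
Qed.
Lemma Yexp_linr u k i j : linear (fun v => Ybar_exp u v k i j).
Proof.
move=> c v v'; rewrite /Ybar_exp scaler_sumr -big_split; apply: eq_bigr => l _ /=.
by rewrite Yshift_linr tens_linearr scalerDr !scalerA mulrC.
Qed.

Lemma Yexp0l v k i j : Ybar_exp 0 v k i j = 0.
Proof.
by have := Yexp_linl v k i j 1 0 0; rewrite !scale1r addr0 => /eqP;
  rewrite -subr_eq subrr eq_sym => /eqP.
Qed.
Lemma Yexp0r u k i j : Ybar_exp u 0 k i j = 0.
Proof.
by have := Yexp_linr u k i j 1 0 0; rewrite !scale1r addr0 => /eqP;
  rewrite -subr_eq subrr eq_sym => /eqP.
Qed.

Lemma Ybar_bound (a b : Vbar V) k N M :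
  (forall n, (N <= n)%N -> a n = 0) -> (forall n, (M <= n)%N -> b n = 0) ->
  Ybar a b k = \sum_(i < N) \sum_(j < M)
    (i`! * j`!)%:R *: Ybar_exp (a i) (b j) k i j.
Proof.
move=> aN bM; pose T i j := (i`! * j`!)%:R *: Ybar_exp (a i) (b j) k i j.
rewrite (fsbig_ord _ _ (fun i => \sum_(j < M) T i j)).
under eq_fsbigr do rewrite fsbig_ord.
rewrite pair_fsbig; [|exact: finite_II|exact: finite_II].
apply/esym/fsbig_widen => // -[i j] [_ /= /not_andP[]] /= /negP;
  rewrite -leqNgt.
  by move=> /aN e /=; rewrite /T e Yexp0l scaler0.
by move=> /bM e /=; rewrite /T e Yexp0r scaler0.
Qed.

Lemma vcoef_fin2 (a b : Vbar V) :
  exists N, forall n, (N <= n)%N -> a n = 0 /\ b n = 0.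
Proof.
have [N aN] := vcoef_fin a; have [M bM] := vcoef_fin b.
exists (maxn N M) => n; rewrite geq_max => /andP[? ?].
by rewrite aN // bM.
Qed.

Lemma Ybar_linl b k : linear (fun a => Ybar a b k).
Proof.
move=> c a a'; have [N aN] := vcoef_fin2 a a'; have [M bM] := vcoef_fin b.
rewrite !(@Ybar_bound _ _ _ N M) //; try by move=> n /aN[].
  rewrite scaler_sumr -big_split; apply: eq_bigr => i _ /=.
  rewrite scaler_sumr -big_split; apply: eq_bigr => j _ /=.
  by rewrite Yexp_linl scalerDr !scalerA mulrC.
by move=> n /aN[]; rewrite vcoefD vcoefZ => -> ->; rewrite scaler0 addr0.
Qed.

Lemma Ybar_linr a k : linear (fun b => Ybar a b k).
Proof.
move=> c b b'; have [N aN] := vcoef_fin a; have [M bM] := vcoef_fin2 b b'.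
rewrite !(@Ybar_bound _ _ _ N M) //; try by move=> n /bM[].
  rewrite scaler_sumr -big_split; apply: eq_bigr => i _ /=.
  rewrite scaler_sumr -big_split; apply: eq_bigr => j _ /=.
  by rewrite Yexp_linr scalerDr !scalerA mulrC.
by move=> n /bM[]; rewrite vcoefD vcoefZ => -> ->; rewrite scaler0 addr0.
Qed.

Lemma Ybar_trunc a b : lower_truncated (Ybar a b).
Proof.
have [N aN] := vcoef_fin a; have [M bM] := vcoef_fin b.
have ltD (f g : int -> Vbar V) : lower_truncated f -> lower_truncated g ->
    lower_truncated (fun k => f k + g k).
  move=> [n fn] [m gm]; exists (Order.min n m) => k.
  by rewrite lt_min => /andP[/fn -> /gm ->]; rewrite addr0.
have ltS (n : nat) (f : nat -> int -> Vbar V) :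
    (forall i, lower_truncated (f i)) ->
    lower_truncated (fun k => \sum_(i < n) f i k).
  move=> lf; elim: n => [|n IH]; first by exists 0 => k _; rewrite big_ord0.
  suff -> : (fun k => \sum_(i < n.+1) f i k) =
    (fun k => \sum_(i < n) f i k + f n k) by apply: ltD.
  by apply/funext => k; rewrite big_ord_recr.
suff -> : Ybar a b = fun k => \sum_(i < N) \sum_(j < M)
    (i`! * j`!)%:R *: Ybar_exp (a i) (b j) k i j.
  apply: (ltS N (fun i k => \sum_(j < M)
    (i`! * j`!)%:R *: Ybar_exp (a i) (b j) k i j)) => i.
  apply: (ltS M (fun j k =>
    (i`! * j`!)%:R *: Ybar_exp (a i) (b j) k i j)) => j.
  have [n Yn] := vY_trunc (a i) (b j).
  exists (n - i%:Z - j%:Z) => k kn; rewrite /Ybar_exp big1 ?scaler0 // => l _.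
  rewrite /Yshift Yn ?scaler0; last by case: l => l /=; lia.
  by rewrite (_ : tens _ 0 = 0) ?scaler0 //; apply: vbarP => m /=; rewrite scaler0.
by apply/funext => k; apply: Ybar_bound.
Qed.

Lemma Ybar_mono i u j v k : Ybar (tens 'X^i u) (tens 'X^j v) k =
  (i`! * j`!)%:R *: Ybar_exp u v k i j.
Proof.
rewrite /Ybar -(@fsbig_widen _ _ _ _ [set (i, j)]) //.
  by rewrite fsbig_set1 /= !coefXn !eqxx !scale1r.
move=> [i' j'] [_ /= ne]; rewrite !coefXn.
case: (i' =P i) => [ei|_]; last by rewrite scale0r Yexp0l scaler0.
case: (j' =P j) => [ej|_]; last by rewrite scale0r Yexp0r scaler0.
by case: ne; rewrite ei ej.
Qed.

Lemma Ybar_tens1 u v k : Ybar (tens 1 u) (tens 1 v) k = tens 1 (vY u v k).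
Proof.
rewrite -(expr0 'X) Ybar_mono /Ybar_exp big_ord_recl big_ord0 addr0 /=.
by rewrite /Yshift /= addr0 binz0 bin0 !fact0 expr0 !mulr1 !scale1r invr1 scale1r.
Qed.

Lemma Yshift_D u v k i j :
  i.+1%:R *: Yshift u v k i.+1 j = (k + 1)%:~R *: Yshift u v (k + 1) i j.
Proof.
rewrite /Yshift !scalerA.
rewrite (_ : k + (i.+1 + j)%N%:Z = k + 1 + (i + j)%N%:Z); last by lia.
congr (_ *: _); rewrite addSn.
set r := k + 1 + _.
have e1 := binzS_mul F r (i + j).
have e2 : i.+1%:R * 'C((i + j).+1, i.+1)%:R = (i + j).+1%:R * 'C(i + j, i)%:R :> F.
  by rewrite -!natrM mul_bin_diag.
rewrite (_ : r - (i + j)%N%:Z = k + 1) in e1; last by rewrite /r; lia.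
move: e1 e2; move: (binz F r (i + j).+1) (binz F r (i + j)) => B B' e1 e2.
transitivity (B * (i.+1%:R * 'C((i + j).+1, i.+1)%:R) * (-1) ^+ j).
  by ring.
rewrite e2; transitivity ((i + j).+1%:R * B * 'C(i + j, i)%:R * (-1) ^+ j).
  by ring.
by rewrite e1; ring.
Qed.

Lemma Yshift_flip u v k i j :
  i.+1%:R *: Yshift u v k i.+1 j = - (j.+1%:R *: Yshift u v k i j.+1).
Proof.
rewrite /Yshift !scalerA -scaleNr addSnnS; congr (_ *: _).
have e : i.+1%:R * 'C(i + j.+1, i.+1)%:R = j.+1%:R * 'C(i + j.+1, i)%:R :> F.
  rewrite -!natrM; congr (_%:R).
  have := mul_bin_left (i + j.+1) i; rewrite addKn => ->.
  by [].
rewrite exprS.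
transitivity (binz F (k + (i + j.+1)%N%:Z) (i + j.+1) *
  (i.+1%:R * 'C(i + j.+1, i.+1)%:R) * (-1) ^+ j); first by ring.
by rewrite e; ring.
Qed.

Lemma tensZr p c (v : V) : tens p (c *: v) = c *: tens p v.
Proof.
by apply: vbarP => n; rewrite vcoefZ /= !scalerA mulrC.
Qed.

Lemma tensNr p (v : V) : tens p (- v) = - tens p v.
Proof. by rewrite -scaleN1r tensZr scaleN1r. Qed.

Lemma vbarD0 : vbarD (0 : Vbar V) = 0.
Proof. by apply: vbarP => -[]. Qed.
Lemma vbarDD (a b : Vbar V) : vbarD (a + b) = vbarD a + vbarD b.
Proof. by have := vbarD_linear 1 a b; rewrite !scale1r. Qed.
Lemma vbarDZ c (a : Vbar V) : vbarD (c *: a) = c *: vbarD a.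
Proof. by have := vbarD_linear c a 0; rewrite vbarD0 !addr0. Qed.

Local Notation B0l := (@Y0l F _ _ Ybar_linl).
Local Notation B0r := (@Y0r F _ _ Ybar_linr).
Local Notation BDl := (@YDl F _ _ Ybar_linl).
Local Notation BDr := (@YDr F _ _ Ybar_linr).

Lemma Yexp_D u v k i j :
  i.+1%:R *: Ybar_exp u v k i.+1 j = (k + 1)%:~R *: Ybar_exp u v (k + 1) i j.
Proof.
rewrite /Ybar_exp !scaler_sumr; apply: eq_bigr => l _.
rewrite !scalerA mulrC [_ * l`!%:R^-1]mulrC -!scalerA.
by congr (_ *: _); rewrite -!tensZr Yshift_D.
Qed.

Lemma vbarD_Yexp u v k i j : vbarD (Ybar_exp u v k i j) =
  i.+1%:R *: Ybar_exp u v k i.+1 j + j.+1%:R *: Ybar_exp u v k i j.+1.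
Proof.
pose t l := l`!%:R^-1 *: tens 'X^l (Yshift u v k i (j.+1 - l)).
have -> : j.+1%:R *: Ybar_exp u v k i j.+1 =
    \sum_(l < j.+2) l%:R *: t l + \sum_(l < j.+2) (j.+1 - l)%:R *: t l.
  rewrite /Ybar_exp scaler_sumr -big_split; apply: eq_bigr => -[l lj] _ /=.
  by rewrite -scalerDl -natrD subnKC.
have -> : \sum_(l < j.+2) l%:R *: t l = vbarD (Ybar_exp u v k i j).
  rewrite big_ord_recl scale0r add0r /Ybar_exp.
  rewrite (big_morph (@vbarD F V) vbarDD vbarD0); apply: eq_bigr => l _.
  rewrite /t /= /bump /= add1n vbarDZ -tensXS subSS scalerA; congr (_ *: _).
  rewrite factS natrM invfM mulrA mulfV ?mul1r //.
  by rewrite pnatr_eq0.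
rewrite big_ord_recr /= subnn scale0r addr0 addrCA.
rewrite [X in _ + X](_ : _ = 0) ?addr0 // /Ybar_exp scaler_sumr -big_split.
apply: big1 => -[l lj] _ /=; rewrite /t subSn //.
rewrite !scalerA mulrC [_ * l`!%:R^-1]mulrC -!scalerA -scalerDr -!tensZr.
by rewrite Yshift_flip tensNr addNr scaler0.
Qed.

Lemma Ybar_D a b k : Ybar (vbarD a) b k = (k + 1)%:~R *: Ybar a b (k + 1).
Proof.
elim/vbar_ind: a => [|a a' IH IH'|i u].
- by rewrite vbarD0 !B0l scaler0.
- by rewrite vbarDD !BDl IH IH' scalerDr.
elim/vbar_ind: b => [|b b' IH IH'|j v].
- by rewrite !B0r scaler0.
- by rewrite !BDr IH IH' scalerDr.
rewrite -tensXS !Ybar_mono factS -mulnA mulnC natrM -scalerA Yexp_D.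
by rewrite !scalerA mulrC.
Qed.

Lemma D_Ybar a b k : vbarD (Ybar a b k) = Ybar (vbarD a) b k + Ybar a (vbarD b) k.
Proof.
elim/vbar_ind: a => [|a a' IH IH'|i u].
- by rewrite vbarD0 !B0l vbarD0 addr0.
- by rewrite vbarDD !BDl vbarDD IH IH' addrACA.
elim/vbar_ind: b => [|b b' IH IH'|j v].
- by rewrite vbarD0 !B0r vbarD0 addr0.
- by rewrite vbarDD !BDr vbarDD IH IH' addrACA.
rewrite -!tensXS !Ybar_mono vbarDZ vbarD_Yexp scalerDr !scalerA -!natrM.
by congr (_%:R *: _ + _%:R *: _); rewrite factS; ring.
Qed.

End Ybar.

Section BorchMorph.
Variables (F : numFieldType) (W W' : lmodType F).
Variables (Y : W -> W -> int -> W) (Y' : W' -> W' -> int -> W').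
Hypothesis Ylinl : forall v k, linear (fun u => Y u v k).
Hypothesis Ylinr : forall u k, linear (fun v => Y u v k).
Hypothesis Ytr : forall u v, lower_truncated (Y u v).
Variable f : W -> W'.
Hypothesis fl : linear f.
Hypothesis fY : forall u v k, f (Y u v k) = Y' (f u) (f v) k.

Lemma borch_morph u v w l m n :
  f (borch Y u v w l m n) = borch Y' (f u) (f v) (f w) l m n.
Proof.
pose fM : {linear W -> W'} := HB.pack f (GRing.isLinear.Build F W W' *:%R f fl).
have fZ c x : f (c *: x) = c *: f x by exact: (linearZ_LR fM).
have fB x y : f (x - y) = f x - f y by exact: (linearB fM).
have [N1 h1] := bt1_evz Ylinr Ytr u v w l m n.
have [N2 h2] := bt2_evz Ylinr Ytr u v w l m n.
have [N3 h3] := bt3_evz Ylinl Ytr u v w l m n.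
rewrite /borch !fB (fsum_lin fl h1) (fsum_lin fl h2) (fsum_lin fl h3).
congr (_ - _ - _); apply: eq_fsbigr => i _.
- by rewrite /bt1 fZ !fY.
- by rewrite /bt2 fZ !fY.
- by rewrite /bt3 fZ !fY.
Qed.
End BorchMorph.

Section BorchLin.
Variables (F : numFieldType) (W : lmodType F).
Variables (Y : W -> W -> int -> W).
Hypothesis Ylinl : forall v k, linear (fun u => Y u v k).
Hypothesis Ylinr : forall u k, linear (fun v => Y u v k).
Hypothesis Ytr : forall u v, lower_truncated (Y u v).
Local Notation e1 := (bt1_evz Ylinr Ytr).
Local Notation e2 := (bt2_evz Ylinr Ytr).
Local Notation e3 := (bt3_evz Ylinl Ytr).
Local Notation D3 := (YDl Ylinl, YDr Ylinr, scalerDr, scale1r).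

Let cmb11 (f g h : nat -> W) : (exists N, evz f N) -> (exists N, evz g N) ->
  (forall i, h i = f i + g i) ->
  \sum_(i \in [set: nat]) h i =
  \sum_(i \in [set: nat]) f i + \sum_(i \in [set: nat]) g i.
Proof.
move=> ef eg E; rewrite (@fsum_cmb _ _ 1 1 f g h) ?scale1r // => i.
by rewrite !scale1r.
Qed.

Lemma borch_addu u u' v w l m n :
  borch Y (u + u') v w l m n = borch Y u v w l m n + borch Y u' v w l m n.
Proof.
rewrite /borch (cmb11 (e1 u v w l m n) (e1 u' v w l m n) (h := bt1 Y (u + u') v w l m n)); last first.
  by move=> i; rewrite /bt1 !D3.
rewrite (cmb11 (e2 u v w l m n) (e2 u' v w l m n) (h := bt2 Y (u + u') v w l m n)); last first.
  by move=> i; rewrite /bt2 !D3.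
rewrite (cmb11 (e3 u v w l m n) (e3 u' v w l m n) (h := bt3 Y (u + u') v w l m n)); last first.
  by move=> i; rewrite /bt3 !D3.
by rewrite rear.
Qed.

Lemma borch_addv u v v' w l m n :
  borch Y u (v + v') w l m n = borch Y u v w l m n + borch Y u v' w l m n.
Proof.
rewrite /borch (cmb11 (e1 u v w l m n) (e1 u v' w l m n) (h := bt1 Y u (v + v') w l m n)); last first.
  by move=> i; rewrite /bt1 !D3.
rewrite (cmb11 (e2 u v w l m n) (e2 u v' w l m n) (h := bt2 Y u (v + v') w l m n)); last first.
  by move=> i; rewrite /bt2 !D3.
rewrite (cmb11 (e3 u v w l m n) (e3 u v' w l m n) (h := bt3 Y u (v + v') w l m n)); last first.
  by move=> i; rewrite /bt3 !D3.
by rewrite rear.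
Qed.

Lemma borch_addw u v w w' l m n :
  borch Y u v (w + w') l m n = borch Y u v w l m n + borch Y u v w' l m n.
Proof.
rewrite /borch (cmb11 (e1 u v w l m n) (e1 u v w' l m n) (h := bt1 Y u v (w + w') l m n)); last first.
  by move=> i; rewrite /bt1 !D3.
rewrite (cmb11 (e2 u v w l m n) (e2 u v w' l m n) (h := bt2 Y u v (w + w') l m n)); last first.
  by move=> i; rewrite /bt2 !D3.
rewrite (cmb11 (e3 u v w l m n) (e3 u v w' l m n) (h := bt3 Y u v (w + w') l m n)); last first.
  by move=> i; rewrite /bt3 !D3.
by rewrite rear.
Qed.

Lemma borch_0 u v w l m n :
  [/\ borch Y 0 v w l m n = 0, borch Y u 0 w l m n = 0
    & borch Y u v 0 l m n = 0].
Proof.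
have z (a : W) : a = a + a -> a = 0.
  by move=> e; apply: (addrI a); rewrite addr0.
split; apply: z.
- by rewrite -borch_addu addr0.
- by rewrite -borch_addv addr0.
- by rewrite -borch_addw addr0.
Qed.

End BorchLin.

Lemma Ybar_jacobi (F : numFieldType) (V : vertexLeibnizType F) :
  vertex_jacobi (@Ybar F V).
Proof.
have Ll := @Ybar_linl F V; have Lr := @Ybar_linr F V.
have Lt := @Ybar_trunc F V.
have D0 : vbarD (0 : Vbar V) = 0 by exact: vbarD0.
apply/jacobiP => a b c; elim/vbar_indD: a => [|a a' IH IH'|u|a IH] l m n.
- by have [] := borch_0 Ll Lr Lt b b c l m n.
- by rewrite borch_addu // IH IH' addr0.
- elim/vbar_indD: b l m n => [|b b' IH IH'|v|b IH] l m n.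
  + by have [] := borch_0 Ll Lr Lt (tens 1 u) c c l m n.
  + by rewrite borch_addv // IH IH' addr0.
  + elim/vbar_indD: c l m n => [|c c' IH IH'|w|c IH] l m n.
    * by have [] := borch_0 Ll Lr Lt (tens 1 u) (tens 1 v) 0 l m n.
    * by rewrite borch_addw // IH IH' addr0.
    * have tl : linear (@tens F V 1) by exact: tens_linearr.
      rewrite -(@borch_morph F V _ (@vY F V) _ (@vY_linearl F V)
        (@vY_linearr F V) (@vY_trunc F V) _ tl); last first.
        by move=> *; rewrite Ybar_tens1.
      have /jacobiP -> := @vY_jacobi F V.
      by apply: vbarP => k /=; rewrite scaler0.
    * rewrite (borchDw Ll Lr Lt (@vbarD_linear F V) (@D_Ybar F V)).
      rewrite IH (borchDu Ll Lr Lt (@Ybar_D F V)) !IH.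
      rewrite (borchDv Ll Lr Lt (@vbarD_linear F V) (@Ybar_D F V) (@D_Ybar F V)).
      by rewrite !IH !scaler0 D0 !addr0 !subr0.
  + rewrite (borchDv Ll Lr Lt (@vbarD_linear F V) (@Ybar_D F V) (@D_Ybar F V)).
    by rewrite !IH !scaler0 addr0.
- by rewrite (borchDu Ll Lr Lt (@Ybar_D F V)) !IH !scaler0 addr0.
Qed.

HB.instance Definition _ (F : numFieldType) (V : vertexLeibnizType F) :=
  isVertexLeibniz.Build F (Vbar V) (@Ybar_linl F V) (@Ybar_linr F V)
    (@Ybar_trunc F V) (@Ybar_jacobi F V).

Section SkewDefect.
Variables (F : numFieldType) (W : lmodType F).
Variables (Y : W -> W -> int -> W) (D : W -> W).
Hypothesis Ylinl : forall v k, linear (fun u => Y u v k).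
Hypothesis Ylinr : forall u k, linear (fun v => Y u v k).
Hypothesis Ytr : forall u v, lower_truncated (Y u v).
Hypothesis Dlin : linear D.
Hypothesis YD : forall u v k, Y (D u) v k = (k + 1)%:~R *: Y u v (k + 1).
Hypothesis DY : forall u v k, D (Y u v k) = Y (D u) v k + Y u (D v) k.
Local Notation S f := (\sum_(i \in [set: nat]) f i).

(* u_n v - sum_i (-1)^(n+i-1) / i! D^i (v_(n+i) u), where u_n v is the
   coefficient of x^(-n-1) in Y(u,x)v *)
Definition skew_defect (u v : W) (n : int) : W :=
  Y u v (- n - 1) - \sum_(i \in [set: nat])
    ((-1) ^ (n + i%:Z - 1) / i`!%:R) *: iter i D (Y v u (- (n + i%:Z) - 1)).

Let st (u v : W) (n : int) (i : nat) : W :=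
  ((-1) ^ (n + i%:Z - 1) / i`!%:R) *: iter i D (Y v u (- (n + i%:Z) - 1)).

Let DM : {linear W -> W} := HB.pack D (GRing.isLinear.Build F W W *:%R D Dlin).
Let DZ c a : D (c *: a) = c *: D a. Proof. exact: (linearZ_LR DM). Qed.
Let D0 : D 0 = 0. Proof. exact: (linear0 DM). Qed.
Let DB a b : D (a - b) = D a - D b. Proof. exact: (linearB DM). Qed.
Let DD a b : D (a + b) = D a + D b. Proof. exact: (linearD DM). Qed.
Let iD0 i : iter i D 0 = 0. Proof. by elim: i => //= i ->. Qed.
Let iDD i a b : iter i D (a + b) = iter i D a + iter i D b.
Proof. by elim: i => //= i ->; rewrite DD. Qed.

Let st_evz u v n : exists N, evz (st u v n) N.
Proof.
have [N h] := mo_evz Ytr v u n; exists N => i iN.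
by rewrite /st h // iD0 scaler0.
Qed.

Lemma skew_defect_D u v n :
  D (skew_defect u v n) = skew_defect (D u) v n + skew_defect u (D v) n.
Proof.
rewrite /skew_defect DB DY [RHS]addrACA; congr (_ + _).
rewrite -[RHS]opprD; congr (- _).
have [N h] := st_evz u v n.
rewrite (fsum_lin Dlin h) (@fsum_cmb _ _ 1 1 (st (D u) v n) (st u (D v) n)).
- by rewrite !scale1r.
- exact: st_evz.
- exact: st_evz.
move=> i; rewrite /st !scale1r DZ -scalerDr -iDD; congr (_ *: _).
by rewrite -iterS iterSr DY addrC.
Qed.

Lemma mo_iter i x w m : Y (iter i D x) w (- m - 1) =
  ((-1) ^+ i * i`!%:R * binz F m i) *: Y x w (- (m - i%:Z) - 1).
Proof.
elim: i m => [|i IH] m.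
  by rewrite binz0 fact0 !mulr1 scale1r subr0.
rewrite iterS YD (_ : - m - 1 + 1 = - (m - 1) - 1); last by lia.
rewrite IH scalerA (_ : m - 1 - i%:Z = m - i.+1%:Z); last by lia.
congr (_ *: _); rewrite (_ : - (m - 1) - 1 = - m); last by lia.
have e := binz_absorb F m i.
rewrite exprS factS natrM intrN.
transitivity (- ((-1) ^+ i * i`!%:R * (m%:~R * binz F (m - 1) i))).
  by ring.
by rewrite -e; ring.
Qed.

Lemma signz_sq (n : int) : (-1) ^ n * (-1) ^ n = 1 :> F.
Proof. by rewrite -expfzMl mulrNN mulr1 exp1rz. Qed.

Lemma skew_defect_l u v n w m :
  (forall u v w l m n, borch Y u v w l m n = 0) ->
  Y (skew_defect u v n) w m = 0.
Proof.
move=> Yb; rewrite (_ : m = - (- m - 1) - 1); last by lia.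
move: (- m - 1) => {}m.
rewrite /skew_defect (YDl Ylinl) (YNl Ylinl).
have [N h] := st_evz u v n.
rewrite -[X in _ - Y X _ _]/(S (st u v n)).
rewrite (fsum_lin (L := fun x => Y x w (- m - 1)) (Ylinl w _) h).
have E3 : S (bt3 Y u v w n 0 m) = Y (Y u v (- n - 1)) w (- m - 1).
  rewrite (@fsum_nat _ _ _ 1) ?big_ord1 => [|[|i] // _].
    by rewrite /bt3 binz0 scale1r addr0 add0r subr0.
  by rewrite /bt3 binz0n scale0r.
have E3' : S (fun i => Y (st u v n i) w (- m - 1)) =
    - ((-1) ^ n) *: S (bt3 Y v u w n m 0).
  have [M hM] := bt3_evz Ylinl Ytr v u w n m 0.
  rewrite -(fsumZ _ hM); apply: eq_fsbigr => i _.
  rewrite /st (YZl Ylinl) mo_iter /bt3 !scalerA addr0; congr (_ *: _).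
  have iN : i`!%:R != 0 :> F by rewrite pnatr_eq0 -lt0n fact_gt0.
  rewrite signz_pred expfzDr ?oppr_eq0 ?oner_neq0 // -exprnP.
  transitivity (- (-1) ^ n * ((-1) ^+ i * (-1) ^+ i) * binz F m i).
    by field.
  by rewrite -signr_odd -signr_addb addbb expr0 mulr1.
rewrite E3' -E3.
have e1 := Yb u v w n 0 m; have e2 := Yb v u w n m 0.
have f1 : S (bt1 Y u v w n 0 m) = (-1) ^ n *: S (bt2 Y v u w n m 0).
  have [M hM] := bt2_evz Ylinr Ytr v u w n m 0.
  rewrite -(fsumZ _ hM); apply: eq_fsbigr => i _.
  rewrite /bt1 /bt2 !scalerA [in RHS]mulrA signz_sq mul1r.
  by rewrite addr0 add0r.
have f2 : S (bt2 Y u v w n 0 m) = (-1) ^ n *: S (bt1 Y v u w n m 0).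
  have [M hM] := bt1_evz Ylinr Ytr v u w n m 0.
  rewrite -(fsumZ _ hM); apply: eq_fsbigr => i _.
  by rewrite /bt1 /bt2 !scalerA [m + n]addrC.
move/eqP: e1; move/eqP: e2; rewrite /borch !subr_eq0 => /eqP <- /eqP <-.
by rewrite f1 f2 scaleNr opprK scalerBr subrKA subrr.
Qed.

End SkewDefect.

Section Span.
Variables (F : numFieldType) (W : lmodType F) (G : set W).

Lemma lspan_submod : submod_closed (fun x : W => `[< lspan (F := F) G x >]).
Proof.
split=> [|c x y /asboolP [s [sG ->]] /asboolP [t [tG ->]]]; apply/asboolP.
  by exists [::]; rewrite big_nil.
exists ([seq (c * p.1, p.2) | p <- s] ++ t); split.
  move=> p; rewrite mem_cat => /orP[/mapP[q qs -> /=]|]; last exact: tG.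
  exact: sG.
rewrite big_cat big_map scaler_sumr /=; congr (_ + _).
by apply: eq_bigr => p _; rewrite scalerA.
Qed.

Lemma lspan_sub x : G x -> lspan (F := F) G x.
Proof.
move=> Gx; exists [:: (1, x)]; rewrite big_seq1 scale1r; split=> // t.
by rewrite inE => /eqP ->.
Qed.

Lemma lspan_ind (P : W -> Prop) : P 0 ->
  (forall c x y, P x -> P y -> P (c *: x + y)) ->
  (forall x, G x -> P x) -> forall x, lspan (F := F) G x -> P x.
Proof.
move=> P0 PD PG x [s [sG ->]]; elim: s sG => [|t s IH] sG.
  by rewrite big_nil.
rewrite big_cons; apply: PD.
  by apply: PG; apply: sG; rewrite mem_head.
by apply: IH => u us; apply: sG; rewrite inE us orbT.
Qed.
End Span.

Section Vtilde.
Variables (F : numFieldType) (V : vertexLeibnizType F).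

Definition Jbar_gen : set (Vbar V) :=
  [set x | exists u v n, x = skew_defect (@vY F (Vbar V)) (@vbarD F V) u v n].

Definition Jbar : {pred Vbar V} := fun x => `[< lspan (F := F) Jbar_gen x >].

Lemma Jbar_submod : submod_closed Jbar.
Proof. exact: lspan_submod. Qed.

HB.instance Definition _ :=
  GRing.isSubmodClosed.Build F (Vbar V) Jbar Jbar_submod.

Lemma Jbar_vbarD a : a \in Jbar -> vbarD a \in Jbar.
Proof.
move=> /asboolP; elim/lspan_ind => [|c x y xJ yJ|x [u [v [n ->]]]].
- by rewrite vbarD0 rpred0.
- by rewrite vbarD_linear; apply: Jbar_submod.2.
rewrite (skew_defect_D (@Ybar_trunc F V) (@vbarD_linear F V) (@D_Ybar F V)).
by apply: rpredD; apply/asboolP/lspan_sub; do 3!eexists.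
Qed.

Lemma Jbar_vYl a b k : a \in Jbar -> vY a b k = 0.
Proof.
have Ll := @Ybar_linl F V.
move=> /asboolP; elim/lspan_ind => [|c x y xJ yJ|x [u [v [n ->]]]].
- exact: (Y0l Ll).
- by rewrite vY_linearl xJ yJ scaler0 addr0.
apply: (skew_defect_l Ll (@Ybar_linr F V) (@Ybar_trunc F V)
  (@vbarD_linear F V) (@Ybar_D F V)).
exact/jacobiP/(@Ybar_jacobi F V).
Qed.

Lemma Jbar_skew a b n : skew_defect (@vY F (Vbar V)) (@vbarD F V) a b n \in Jbar.
Proof. by apply/asboolP/lspan_sub; exists a, b, n. Qed.

Lemma Jbar_vYr a b k : b \in Jbar -> vY a b k \in Jbar.
Proof.
move=> bJ; have := Jbar_skew a b (- k - 1).
rewrite /skew_defect (_ : - (- k - 1) - 1 = k); last by lia.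
rewrite fsbig1 ?subr0 // => i _; rewrite Jbar_vYl //.
suff -> : iter i (@vbarD F V) 0 = 0 by rewrite scaler0.
by elim: i => //= i ->; rewrite vbarD0.
Qed.

Definition Vtilde := Quotient.quot Jbar.

HB.instance Definition _ := GRing.Zmodule.on Vtilde.
HB.instance Definition _ := EqQuotient.on Vtilde.

Definition vproj (a : Vbar V) : Vtilde := \pi_Vtilde%qT a.


Lemma vproj_repr x : vproj (repr x) = x. Proof. exact: reprK. Qed.

Lemma vprojP a b : vproj a = vproj b <-> a - b \in Jbar.
Proof.
have -> : (a - b \in Jbar) = (vproj a == vproj b) by exact: Quotient.idealrBE.
by split=> /eqP.
Qed.

Lemma vprojD a b : vproj (a + b) = vproj a + vproj b.
Proof. exact: (@pi_addr _ _ _ _ _ (Quotient.quot Jbar)). Qed.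

Lemma repr_vproj a : repr (vproj a) - a \in Jbar.
Proof. by apply/vprojP; rewrite vproj_repr. Qed.

Definition vtscale (c : F) (x : Vtilde) : Vtilde := vproj (c *: repr x).

Lemma vtscaleE c a : vtscale c (vproj a) = vproj (c *: a).
Proof. by apply/vprojP; rewrite -scalerBr rpredZ // repr_vproj. Qed.

Lemma vtscaleA c d x : vtscale c (vtscale d x) = vtscale (c * d) x.
Proof. by rewrite -[x]vproj_repr !vtscaleE scalerA. Qed.
Lemma vtscale1 : left_id 1 vtscale.
Proof. by move=> x; rewrite -[x]vproj_repr vtscaleE scale1r. Qed.
Lemma vtscaleDr : right_distributive vtscale +%R.
Proof.
move=> c x y; rewrite -[x]vproj_repr -[y]vproj_repr.
by rewrite !vtscaleE -!vprojD vtscaleE scalerDr.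
Qed.
Lemma vtscaleDl x : {morph vtscale^~ x : c d / c + d}.
Proof. by move=> c d; rewrite -[x]vproj_repr !vtscaleE -vprojD scalerDl. Qed.

HB.instance Definition _ := GRing.Zmodule_isLmodule.Build F Vtilde
  vtscaleA vtscale1 vtscaleDr vtscaleDl.

Lemma vproj_linear : linear vproj.
Proof. by move=> c a b; rewrite vprojD -vtscaleE. Qed.

Definition Ytilde (x y : Vtilde) (k : int) : Vtilde :=
  vproj (vY (repr x) (repr y) k).

Definition vtD (x : Vtilde) : Vtilde := vproj (vbarD (repr x)).

Lemma YtildeE a b k : Ytilde (vproj a) (vproj b) k = vproj (vY a b k).
Proof.
apply/vprojP; set a' := repr _; set b' := repr _.
have -> : vY a' b' k - vY a b k = vY (a' - a) b' k + vY a (b' - b) k.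
  rewrite (YDl (@vY_linearl F _)) (YNl (@vY_linearl F _)).
  by rewrite (YDr (@vY_linearr F _)) (YNr (@vY_linearr F _)) subrKA.
by rewrite Jbar_vYl ?repr_vproj // add0r Jbar_vYr // repr_vproj.
Qed.

Lemma vtDE a : vtD (vproj a) = vproj (vbarD a).
Proof.
apply/vprojP; have -> : vbarD (repr (vproj a)) - vbarD a =
    vbarD (repr (vproj a) - a).
  by rewrite vbarDD -scaleN1r -vbarDZ scaleN1r.
exact/Jbar_vbarD/repr_vproj.
Qed.

Lemma Ytilde_linl y k : linear (fun x => Ytilde x y k).
Proof.
move=> c x x'; rewrite -[x]vproj_repr -[x']vproj_repr -[y]vproj_repr.
by rewrite -vproj_linear !YtildeE vY_linearl vproj_linear.
Qed.

Lemma Ytilde_linr x k : linear (fun y => Ytilde x y k).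
Proof.
move=> c y y'; rewrite -[x]vproj_repr -[y]vproj_repr -[y']vproj_repr.
by rewrite -vproj_linear !YtildeE vY_linearr vproj_linear.
Qed.

Lemma vproj0 : vproj 0 = 0.
Proof. by have := vproj_linear (- 1) 0 0; rewrite scaler0 addr0 scaleN1r addNr. Qed.

Lemma Ytilde_trunc x y : lower_truncated (Ytilde x y).
Proof.
have [N h] := vY_trunc (repr x) (repr y); exists N => k kN.
by rewrite /Ytilde h // vproj0.
Qed.

Lemma Ytilde_jacobi : vertex_jacobi Ytilde.
Proof.
apply/jacobiP => u v w l m n.
rewrite -[u]vproj_repr -[v]vproj_repr -[w]vproj_repr.
rewrite -(borch_morph (@vY_linearl F (Vbar V)) (@vY_linearr F _)
  (@vY_trunc F _) vproj_linear); last by move=> *; rewrite YtildeE.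
by have /jacobiP -> := @vY_jacobi F (Vbar V); rewrite vproj0.
Qed.

HB.instance Definition _ := isVertexLeibniz.Build F Vtilde
  Ytilde_linl Ytilde_linr Ytilde_trunc Ytilde_jacobi.

Lemma vtD_linear : linear vtD.
Proof.
move=> c x y; rewrite -[x]vproj_repr -[y]vproj_repr -vproj_linear !vtDE.
by rewrite vbarD_linear vproj_linear.
Qed.

Lemma Ytilde_D v w : vY (vtD v) w =1 sderiv (vY v w).
Proof.
move=> k; rewrite -[v]vproj_repr -[w]vproj_repr /sderiv -![vY _ _]/(Ytilde _ _).
rewrite vtDE !YtildeE [vY _ _ _]Ybar_D.
by rewrite -[RHS]addr0 -vproj0 -vproj_linear addr0.
Qed.

Lemma vproj_fsum (f : nat -> Vbar V) N : evz f N ->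
  vproj (\sum_(i \in [set: nat]) f i) = \sum_(i \in [set: nat]) vproj (f i).
Proof. exact: fsum_lin vproj_linear. Qed.

Lemma vproj_iter i a : iter i vtD (vproj a) = vproj (iter i (@vbarD F V) a).
Proof. by elim: i => //= i ->; rewrite vtDE. Qed.

Lemma vprojZ c a : vproj (c *: a) = c *: vproj a.
Proof. by rewrite -[RHS]addr0 -vproj0 -vproj_linear addr0. Qed.

Lemma iter_vbarDZ i c (a : Vbar V) :
  iter i (@vbarD F V) (c *: a) = c *: iter i (@vbarD F V) a.
Proof. by elim: i => //= i ->; rewrite vbarDZ. Qed.

Lemma Ytilde_skew u v : vY u v =1 sexp vtD (sopp (vY v u)).
Proof.
move=> k; rewrite -[u]vproj_repr -[v]vproj_repr /sexp /sopp.
set a := repr u; set b := repr v.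
have := Jbar_skew a b (- k - 1); rewrite /skew_defect => /vprojP.
rewrite (_ : - (- k - 1) - 1 = k); last by lia.
rewrite -[vY (vproj a) _]/(Ytilde _ _) YtildeE => ->.
have [N h] := mo_evz (@vY_trunc F (Vbar V)) b a (- k - 1).
rewrite (@vproj_fsum _ N); last first.
  move=> i iN; rewrite h //.
  suff -> : iter i (@vbarD F V) 0 = 0 by rewrite scaler0.
  by elim: i {iN} => //= i ->; rewrite vbarD0.
apply: eq_fsbigr => i _.
rewrite vprojZ.
rewrite (_ : - (- k - 1 + i%:Z) - 1 = k - i%:Z); last by lia.
rewrite -[vY (vproj b) _]/(Ytilde _ _) YtildeE.
rewrite -[_ *: vproj (vY _ _ _)]vprojZ vproj_iter.
rewrite iter_vbarDZ vprojZ scalerA mulrC; congr (_ * _ *: _).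
rewrite (_ : - k - 1 + i%:Z - 1 = - (k - i%:Z) - 1 - 1); last by lia.
by rewrite !signz_pred opprK -exprz_inv invrN invr1.
Qed.

HB.instance Definition _ := isVertexWithoutVacuum.Build F Vtilde
  vtD_linear Ytilde_D Ytilde_skew.

Definition pi_V (v : V) : Vtilde := vproj (tens 1 v).

Lemma pi_V_hom : vl_hom pi_V.
Proof.
split=> [c u v|u v k]; first by rewrite /pi_V tens_linearr vproj_linear.
by rewrite /pi_V -[RHS]/(Ytilde _ _ _) YtildeE -[vY (tens 1 u) _ _]/(Ybar _ _ _) Ybar_tens1.
Qed.

End Vtilde.

(* Main.v *)
Require Import Defs.
From HB Require Import structures.
From mathcomp Require Import all_boot all_order all_algebra.
From mathcomp Require Import all_classical reals complex.
From mathcomp Require Import ring zify.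

(** Skew-symmetry together with [Y(Dv,x) = d/dx Y(v,x)] makes D a derivation of
    any vertex algebra without vacuum K.  Hence a homomorphism [psi : V -> K] of
    vertex Leibniz algebras extends along [D^i u |-> D^i (psi u)] to a D-equivariant
    homomorphism on [F[D] (x) V]: both sides of the homomorphism identity obey
    the same recursion when D is applied to either argument.  The extension kills
    the skew-symmetry defects, because they vanish in K, so it descends to the
    quotient; it is determined by [psi] since V generates [F[D] (x) V] under D. *)

Set Implicit Arguments.
Unset Strict Implicit.
Unset Printing Implicit Defensive.

Import Order.TTheory GRing.Theory Num.Theory.
Local Open Scope ring_scope.
Local Open Scope complex_scope.

Lemma signz_succ (F : fieldType) (k : int) : (-1) ^ (k + 1) = - (-1) ^ k :> F.
Proof. by rewrite exprzDr ?unitrN1 // expr1z mulrN1. Qed.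

Lemma map0_linear (F : pzRingType) (U W : lmodType F) (f : U -> W) :
  linear f -> f 0 = 0.
Proof. by move=> /scalable_linear fZ; have := fZ 0 0; rewrite /= !scale0r. Qed.

(** * The operator D of a vertex algebra without vacuum *)

Section VertexWithoutVacuum.
Variables (F : numFieldType) (K : vertexWithoutVacuumType F).
Implicit Types (u v w : K) (k n : int).

Lemma vDZ c u : vD (c *: u) = c *: vD u.
Proof. exact: (scalable_linear vD_linear). Qed.

Lemma iter_vD_linear i : linear (iter i (@vD F K)).
Proof. by elim: i => // i IH c u v /=; rewrite IH vD_linear. Qed.

Lemma iter_vDZ i c u : iter i vD (c *: u) = c *: iter i vD u.
Proof. exact: (scalable_linear (iter_vD_linear i)). Qed.

Lemma iter_vD0 i : iter i vD (0 : K) = 0.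
Proof. exact: map0_linear (iter_vD_linear i). Qed.

(** Lower truncation makes each coefficient of [e^(xD) f(x)] a finite sum, as the linearity lemmas
    for finite-support sums require. *)
Lemma sexp_evz (f : int -> K) k : lower_truncated f ->
  exists N, evz (fun i => i`!%:R^-1 *: iter i vD (f (k - i%:Z))) N.
Proof.
move=> [n fn]; exists (absz (k - n)).+1 => i iN.
by rewrite fn ?iter_vD0 ?scaler0 //; lia.
Qed.

Lemma sopp_trunc (f : int -> K) : lower_truncated f -> lower_truncated (sopp f).
Proof. by move=> [n fn]; exists n => k /fn; rewrite /sopp => ->; rewrite scaler0. Qed.

(* The coefficient form of d/dx applied to [Y(u,x)v = e^(xD) Y(v,-x)u]. *)
Lemma vD_vY u v k : vD (vY u v k) = vY (vD u) v k + vY u (vD v) k.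
Proof.
have tr w w' := sopp_trunc (@vY_trunc F K w w').
have [N fN] := sexp_evz k (tr v u).
suff -> : vY (vD u) v k = vD (vY u v k) - vY u (vD v) k by rewrite subrK.
rewrite vY_D /sderiv vY_skew [vY u (vD v) k]vY_skew [vY u v k]vY_skew.
rewrite /sexp (fsum_lin vD_linear fN).
have [M gM] := sexp_evz (k + 1) (tr v u); rewrite -(fsumZ _ gM).
rewrite -[X in X - _]scale1r -[X in _ - X]scale1r -scaleNr.
(* The outer D raises the power of D by one, so its term [i] is matched with term [i.+1] of the
   other two series. The coefficients of [D^(i+1)] then agree because
   [k + 1 = (i + 1) + (k - i)]. *)
apply: fsum_shift => [|||i].
- exists N => i iN; rewrite fN //; exact: (iter_vD0 1).
- exact: sexp_evz.
- rewrite /sopp /= !subr0 vY_D /sderiv !scalerA signz_succ.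
  by congr (_ *: _); ring.
rewrite /sopp vY_D /sderiv !iter_vDZ !vDZ -!iterS !scalerA.
rewrite (_ : k - i.+1%:Z + 1 = k - i%:Z); last by lia.
rewrite (_ : k + 1 - i.+1%:Z = k - i%:Z); last by lia.
rewrite -scalerDl; congr (_ *: _).
rewrite (_ : k - i.+1%:Z = k - i%:Z - 1) ?signz_pred; last by lia.
have ni : i.+1%:R != 0 :> F by rewrite pnatr_eq0.
have nf : i`!%:R != 0 :> F by rewrite pnatr_eq0 -lt0n fact_gt0.
rewrite factS natrM !intrD intrN -[i%:Z%:~R]/(i%:R) -natr1 in ni *.
by field; rewrite nf ni.
Qed.
End VertexWithoutVacuum.

(** * Extension of [psi] to [Vbar V] and descent to [Vtilde V] *)

Section Extension.
Variables (F : numFieldType) (V : vertexLeibnizType F).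
Variables (K : vertexWithoutVacuumType F) (psi : V -> K).
Hypothesis hpsi : vl_hom psi.

Implicit Types a b : Vbar V.

Let psi0 : psi 0 = 0.
Proof. exact: map0_linear (vl_hom_linear hpsi). Qed.

Definition vbar_ext (a : Vbar V) : K :=
  \sum_(i \in [set: nat]) iter i vD (psi (a i)).

Lemma vbar_ext_evz a : exists N, evz (fun i => iter i vD (psi (a i))) N.
Proof.
by have [N aN] := vcoef_fin a; exists N => i /aN ->; rewrite psi0 iter_vD0.
Qed.

Lemma vbar_ext_linear : linear vbar_ext.
Proof.
move=> c a b; rewrite /vbar_ext -[X in _ = _ + X]scale1r; apply: fsum_cmb.
- exact: vbar_ext_evz.
- exact: vbar_ext_evz.
move=> i; rewrite vcoefD vcoefZ (vl_hom_linear hpsi) iter_vD_linear.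
by rewrite scale1r.
Qed.

Lemma vbar_ext0 : vbar_ext 0 = 0.
Proof. exact: map0_linear vbar_ext_linear. Qed.

Lemma vbar_extD a b : vbar_ext (a + b) = vbar_ext a + vbar_ext b.
Proof. by rewrite -[a]scale1r vbar_ext_linear !scale1r. Qed.

Lemma vbar_extZ c a : vbar_ext (c *: a) = c *: vbar_ext a.
Proof. exact: (scalable_linear vbar_ext_linear). Qed.

Lemma vbar_extB a b : vbar_ext (a - b) = vbar_ext a - vbar_ext b.
Proof. by rewrite vbar_extD -scaleN1r vbar_extZ scaleN1r. Qed.

Lemma vbar_ext_tens1 v : vbar_ext (tens 1 v) = psi v.
Proof.
rewrite /vbar_ext (@fsum_nat _ _ _ 1) ?big_ord1 => [|[|i] // _] /=.
  by rewrite coef1 scale1r.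
by rewrite -iterS coef1 scale0r psi0 iter_vD0.
Qed.

Lemma vbar_ext_vbarD a : vbar_ext (vbarD a) = vD (vbar_ext a).
Proof.
have [N aN] := vbar_ext_evz a; have [M bM] := vbar_ext_evz (vbarD a).
(* Multiplication by D shifts coefficients up by one, so the split-off term 0 vanishes and each
   remaining term gains one D. *)
by rewrite /vbar_ext (fsum_lin vD_linear aN) (fsumS bM) /= psi0 add0r.
Qed.

Lemma vbar_ext_iter i a :
  vbar_ext (iter i (@vbarD F V) a) = iter i vD (vbar_ext a).
Proof. by elim: i => //= i <-; rewrite vbar_ext_vbarD. Qed.

Lemma vbar_ext_vY a b k : vbar_ext (vY a b k) = vY (vbar_ext a) (vbar_ext b) k.
Proof.
have Ll := @vY_linearl F K; have Lr := @vY_linearr F K.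
have Bl := @vY_linearl F (Vbar V); have Br := @vY_linearr F (Vbar V).
(* [k] stays general, since the coefficient of [Y(Da,x)] at [k] involves that of [Y(a,x)] at
   [k + 1]. *)
elim/vbar_indD: a k => [|a a' IH IH'|u|a IH] k.
- by rewrite (Y0l Bl) vbar_ext0 (Y0l Ll).
- by rewrite (YDl Bl) !vbar_extD IH IH' (YDl Ll).
- elim/vbar_indD: b k => [|b b' IH IH'|v|b IH] k.
  + by rewrite (Y0r Br) vbar_ext0 (Y0r Lr).
  + by rewrite (YDr Br) !vbar_extD IH IH' (YDr Lr).
  + by rewrite [vY _ _ _]Ybar_tens1 !vbar_ext_tens1 (vl_hom_vY hpsi).
  (* The derivation property moves D off the second argument. Both resulting terms involve only
     [Y(u,x)b], at [k] and [k + 1], where the induction hypothesis on [b] applies. *)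
  have -> : vY (tens 1 u) (vbarD b) k =
      vbarD (vY (tens 1 u) b k) - vY (vbarD (tens 1 u)) b k.
    by rewrite [vbarD (vY _ _ _)]D_Ybar addrC addKr.
  rewrite [vY (vbarD _) _ _]Ybar_D vbar_extB vbar_extZ !vbar_ext_vbarD.
  by rewrite -[Ybar _ _ _]/(vY _ _ _) !IH vD_vY vY_D addrC addKr.
by rewrite [vY _ _ _]Ybar_D vbar_extZ -[Ybar _ _ _]/(vY _ _ _) IH vbar_ext_vbarD vY_D.
Qed.

(** The defect is sent to the difference of the two sides of skew-symmetry in [K], at the
    coefficient of [x^(-n-1)]. *)
Lemma vbar_ext_skew a b n :
  vbar_ext (skew_defect (@vY F (Vbar V)) (@vbarD F V) a b n) = 0.
Proof.
rewrite /skew_defect vbar_extB vbar_ext_vY vY_skew; apply/eqP; rewrite subr_eq0.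
have [N h] := mo_evz (@vY_trunc F (Vbar V)) b a n.
rewrite (@fsum_lin _ _ _ _ _ N vbar_ext_linear); last first.
  move=> i iN; rewrite h //.
  suff -> : iter i (@vbarD F V) 0 = 0 by rewrite scaler0.
  by elim: i {iN} => //= i ->; rewrite vbarD0.
apply/eqP/eq_fsbigr => i _.
rewrite vbar_extZ vbar_ext_iter vbar_ext_vY /sopp iter_vDZ scalerA.
rewrite (_ : - (n + i%:Z) - 1 = - n - 1 - i%:Z); last by lia.
rewrite [in RHS]mulrC; congr (_ * _ *: _).
(* With [p = - n - 1 - i], the two signs are [(-1)^(-p-2)] and [(-1)^p], which are equal. *)
rewrite (_ : n + i%:Z - 1 = - (- n - 1 - i%:Z) - 1 - 1); last by lia.
by rewrite !signz_pred opprK -exprz_inv invrN invr1.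
Qed.

Lemma vbar_ext_Jbar a : a \in @Jbar F V -> vbar_ext a = 0.
Proof.
move=> /asboolP; elim/lspan_ind => [|c x y xJ yJ|x [u [v [n ->]]]].
- exact: vbar_ext0.
- by rewrite vbar_ext_linear xJ yJ scaler0 addr0.
exact: vbar_ext_skew.
Qed.

(** The choice of representative is immaterial by [vtilde_extE]. *)
Definition vtilde_ext (x : Vtilde V) : K := vbar_ext (repr x).

Lemma vtilde_extE a : vtilde_ext (vproj a) = vbar_ext a.
Proof.
apply/eqP; rewrite -subr_eq0 /vtilde_ext -vbar_extB vbar_ext_Jbar //.
exact: repr_vproj.
Qed.

Lemma vtilde_ext_hom : va_hom vtilde_ext.
Proof.
split; first split.
- move=> c x y; rewrite -[x]vproj_repr -[y]vproj_repr -vproj_linear.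
  by rewrite !vtilde_extE vbar_ext_linear.
- move=> x y k; rewrite -[x]vproj_repr -[y]vproj_repr.
  by rewrite [vY _ _ _]YtildeE !vtilde_extE vbar_ext_vY.
move=> x; rewrite -[x]vproj_repr [vD _]vtDE !vtilde_extE.
exact: vbar_ext_vbarD.
Qed.

Lemma vtilde_ext_pi_V : vtilde_ext \o @pi_V F V = psi.
Proof. by apply/funext => v; rewrite /= vtilde_extE vbar_ext_tens1. Qed.

End Extension.

(** * Uniqueness and the universal property *)

Lemma va_hom_pi_V_inj (F : numFieldType) (V : vertexLeibnizType F)
    (K : vertexWithoutVacuumType F) (f g : Vtilde V -> K) :
  va_hom f -> va_hom g -> f \o @pi_V F V = g \o @pi_V F V -> f = g.
Proof.
move=> [[fl _] fD] [[gl _] gD] fg; apply/funext => x; rewrite -[x]vproj_repr.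
elim/vbar_indD: (repr x) => [|a b fa fb|v|a fa].
- by rewrite vproj0 (map0_linear fl) (map0_linear gl).
- by rewrite vprojD -[vproj a]scale1r fl gl !scale1r fa fb.
- exact: (congr1 (fun h => h v) fg).
by rewrite -vtDE [f _]fD [g _]gD fa.
Qed.

Theorem proposition2p35 (R : realType) (V : vertexLeibnizType R[i])
    (K : vertexWithoutVacuumType R[i]) (psi : V -> K) (hpsi : vl_hom psi) :
  exists! psit : Vtilde V -> K, va_hom psit /\ psit \o @pi_V _ V = psi.
Proof.
exists (vtilde_ext psi); split=> [|f [fh fpi]].
  by split; [exact: vtilde_ext_hom | exact: vtilde_ext_pi_V].
apply: va_hom_pi_V_inj (vtilde_ext_hom hpsi) fh _.
by rewrite fpi vtilde_ext_pi_V.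
Qed.
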